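(* Let $n\geq 2$ be an integer and let $L$ be a quasigroup of order $n$ with underlying set $I_n=\{1,2,\ldots,n\}$, whose product of $x$ and $y$ is written $xy$. Let $\Gamma_2$ be the digraph with vertex set $I_n\times I_n\times\mathbb{Z}_3$ whose darts (arcs) are exactly the following: \begin{itemize} \item $(x,y,i)\mapsto(z,y,i)$ for all $i\in\mathbb{Z}_3$, $x,y,z\in I_n$, $x\neq z$; \item $(x,y,i)\mapsto(x,z,i)$ for all $i\in\mathbb{Z}_3$, $x,y,z\in I_n$, $y\neq z$; \item $(x,y,i)\mapsto(xy,z,i+1)$ for all $i\in\mathbb{Z}_3$, $x,y,z\in I_n$; \item $(x,y,i)\mapsto(z,yx,i-1)$ for all $i\in\mathbb{Z}_3$, $x,y,z\in I_n$. \end{itemize} Then $\Gamma_2$ is a directed strongly regular graph with parameter set $(3n^2,\,4n-2,\,2n,\,n,\,4)$.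
   Context: A quasigroup is a set $Q$ with a binary operation such that for all $a,b\in Q$ each of the equations $ax=b$ and $ya=b$ has a unique solution in $Q$; equivalently, its multiplication table is a Latin square, $xy$ being the symbol in row $x$ and column $y$. (In particular loops, i.e. quasigroups with an identity element, are allowed.) A directed strongly regular graph (DSRG) with parameter set $(N,k,t,\lambda,\mu)$ (in this order) is a loopless directed graph on $N$ vertices that is regular of valency $k$ (every vertex has in-degree and out-degree $k$), such that every vertex is incident with exactly $t$ undirected edges (an undirected edge is a pair of opposite arcs), and for any two distinct vertices $x,y$ the number of directed paths of length 2 from $x$ to $y$ is $\lambda$ if there is an arc from $x$ to $y$ and $\mu$ otherwise. Equivalently, its adjacency matrix $A$ (with zero diagonal) satisfies $AJ=JA=kJ$ and $A^2=tI+\lambda A+\mu(J-I-A)$, where $J$ is the all-one matrix and $I$ the identity matrix. *)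

(* Defs.v *)
From mathcomp Require Import all_boot all_algebra.

Set Implicit Arguments.
Unset Strict Implicit.
Unset Printing Implicit Defensive.

Definition quasigroup (Q : Type) (op : Q -> Q -> Q) : Prop :=
  forall a b : Q, (exists! x, op a x = b) /\ (exists! y, op y a = b).

(* The digraph [e] has an arc from [u] to [v] when [e u v]; an undirected edge
   is a pair of opposite arcs. *)
Record dsrg (T : finType) (e : rel T) (N k t lambda mu : nat) : Prop := Dsrg {
  dsrg_order : #|T| = N;
  dsrg_loopless : forall u : T, ~~ e u u;
  dsrg_outdeg : forall u : T, #|[set v | e u v]| = k;
  dsrg_indeg : forall u : T, #|[set v | e v u]| = k;
  dsrg_undirected : forall u : T, #|[set v | e u v && e v u]| = t;
  dsrg_paths2 : forall u v : T, u != v ->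
    #|[set w | e u w && e w v]| = if e u v then lambda else mu
}.

(* ['I_n] is {0, ..., n-1} rather than {1, ..., n}; only its cardinality
   matters, since [op] is arbitrary. *)
Definition Gamma2 (n : nat) (op : 'I_n -> 'I_n -> 'I_n) :
    rel ('I_n * 'I_n * 'Z_3)%type :=
  fun u v => let: (x, y, i) := u in
  [|| [exists z : 'I_n, (x != z) && (v == (z, y, i))],
      [exists z : 'I_n, (y != z) && (v == (x, z, i))],
      [exists z : 'I_n, v == (op x y, z, (i + 1)%R)]
    | [exists z : 'I_n, v == (z, op y x, (i - 1)%R)]].

(* Main.v *)
Require Import Defs.
From mathcomp Require Import all_boot all_algebra.
From mathcomp Require Import zify.

(** Within a layer the arcs form the n x n rook graph.  Counting paths of length
    2 layer by layer, every condition either fixes one coordinate or is a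
    quasigroup equation with a unique solution, so each layer contributes 0, 1,
    2, n - 2 or n - 1 paths.  The map (x, y, i) |-> (y, x, -i) is an
    automorphism exchanging the two kinds of arcs between layers. *)

Set Implicit Arguments.
Unset Strict Implicit.
Unset Printing Implicit Defensive.

Import GRing.Theory.

(** * Cardinalities of graphs of functions and of slices of a product *)

Lemma card_graph1 (S T : finType) (f : S -> T) :
  #|[set s : S * T | s.2 == f s.1]| = #|S|.
Proof.
rewrite -(card_imset predT (f := fun x => (x, f x))); last by move=> x y [].
apply: eq_card => -[x y]; rewrite inE /=; apply/eqP/imsetP => [->|[z _ [-> ->]] //].
by exists x.
Qed.

Lemma card_graph2 (S T : finType) (f : S -> T) :
  #|[set s : T * S | s.1 == f s.2]| = #|S|.
Proof.
rewrite -(card_imset predT (f := fun x => (f x, x))); last by move=> x y [].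
apply: eq_card => -[x y]; rewrite inE /=; apply/eqP/imsetP => [->|[z _ [-> ->]] //].
by exists y.
Qed.

Lemma card_pair1 (S T : finType) (a : S) (B : {set T}) :
  #|[set s : S * T | (s.1 == a) && (s.2 \in B)]| = #|B|.
Proof.
rewrite -[RHS]mul1n -(cards1 a) -cardsX; apply: eq_card => -[x y].
by rewrite !inE.
Qed.

Lemma card_pair2 (S T : finType) (A : {set S}) (b : T) :
  #|[set s : S * T | (s.2 == b) && (s.1 \in A)]| = #|A|.
Proof.
rewrite -[RHS]muln1 -(cards1 b) -cardsX; apply: eq_card => -[x y].
by rewrite !inE andbC.
Qed.

(** * Degrees and common neighbours in the rook graph *)

Section Rook.
Variable T : finType.
Implicit Types (x y : T) (s : T * T).

(** The exclusive or excludes [s = s'], where both coordinates agree, so the graph is loopless. *)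
Definition rook s s' := (s.1 == s'.1) (+) (s.2 == s'.2).

Lemma rook_sym s s' : rook s s' = rook s' s.
Proof. by rewrite /rook eq_sym [s.2 == _]eq_sym. Qed.

Lemma card_rook s : #|[set w | rook s w]| = 2 * (#|T| - 1).
Proof.
case: s => x y.
transitivity (#|[set w : T * T | (w.1 == x) && (w.2 \in [set~ y])]
              :|: [set w : T * T | (w.2 == y) && (w.1 \in [set~ x])]|).
  apply: eq_card => -[p q]; rewrite !inE /rook /= ![_ == p]eq_sym ![_ == q]eq_sym.
  by case: (p == x); case: (q == y).
rewrite cardsU card_pair1 card_pair2 !cardsC1 (_ : _ :&: _ = set0).
  by rewrite cards0; lia.
by apply/setP=> -[p q]; rewrite !inE /=; case: (p == x); case: (q == y).
Qed.

(** Two cells on a common line share the other [#|T| - 2] cells of that line; two cells in general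
    position share the two remaining corners of the rectangle they span. *)
Lemma card_rook2 s s' : s != s' ->
  #|[set w | rook s w && rook w s']| = if rook s s' then #|T| - 2 else 2.
Proof.
have card_neq2 (a b : T) : a != b -> #|~: [set a; b]| = #|T| - 2.
  by move=> ab; rewrite cardsCs setCK cards2 ab.
case: s s' => x y [a b]; rewrite xpair_eqE /rook /=.
have [<-{a}|xa] := eqVneq x a; have [<-{b}|yb] //= := eqVneq y b => _.
- rewrite -(card_neq2 y b yb) -(card_pair1 x); apply: eq_card => -[p q].
  rewrite !inE /= ![x == p]eq_sym ![_ == q]eq_sym.
  have [->|_] := eqVneq q y; first by rewrite (negPf yb); case: (p == x).
  by case: (p == x); case: (q == b).
- rewrite -(card_neq2 x a xa) -(card_pair2 _ y); apply: eq_card => -[p q].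
  rewrite !inE /= ![x == p]eq_sym ![_ == q]eq_sym.
  have [->|_] := eqVneq p x; first by rewrite (negPf xa); case: (q == y).
  by case: (q == y); case: (p == a).
rewrite (_ : [set w | _] = [set (x, b); (a, y)]).
  by rewrite cards2 xpair_eqE (negPf xa).
apply/setP=> -[p q]; rewrite !inE /= !xpair_eqE ![x == p]eq_sym ![y == q]eq_sym.
have [->|px] := eqVneq p x; have [->|qy] := eqVneq q y => //=.
- by rewrite (negPf xa) (negPf yb).
- by rewrite (negPf xa); case: (q == b).
- by rewrite (negPf yb); case: (p == a).
by rewrite andbF.
Qed.

(** The column [c] is what an arc into the next layer can reach. If [s] lies in it, all its other
    cells are neighbours of [s]; otherwise only [(c, s.2)] is. *)
Lemma card_rook_column c s :
  #|[set w : T * T | (w.1 == c) && rook w s]| = if s.1 == c then #|T| - 1 else 1.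
Proof.
case: s => a b; rewrite /rook /=; have [->|ac] := eqVneq a c.
  rewrite subn1 -(cardsC1 b) -(card_pair1 c); apply: eq_card => -[p q].
  by rewrite !inE /=; case: eqVneq.
rewrite -(cards1 (c, b)); apply: eq_card => -[p q]; rewrite !inE /= xpair_eqE.
by have [->|] //= := eqVneq p c; rewrite eq_sym (negPf ac).
Qed.

End Rook.

(** * Splitting a count over the three layers *)

Section Layers.
Local Open Scope ring_scope.

Lemma Z3_cases (i j : 'Z_3) : [\/ j = i, j = i + 1 | j = i - 1].
Proof.
have : [|| j == i, j == i + 1 | j == i - 1].
  by case: i j => [[|[|[|//]]] ?] [[|[|[|//]]] ?].
by case/or3P=> /eqP; [constructor 1|constructor 2|constructor 3].
Qed.

Lemma Z3_neq (i : 'Z_3) :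
  [/\ (i + 1 == i) = false, (i - 1 == i) = false,
      (i + 1 == i - 1) = false & (i - 1 == i + 1) = false].
Proof. by case: i => [[|[|[|//]]] ?]. Qed.

Lemma Z3_addr2 (i : 'Z_3) : i + 1 + 1 = i - 1.
Proof. by apply/val_inj; case: i => [[|[|[|//]]] ?]. Qed.

Lemma Z3_subr2 (i : 'Z_3) : i - 1 - 1 = i + 1.
Proof. by apply/val_inj; case: i => [[|[|[|//]]] ?]. Qed.

(** The sum is centred at an arbitrary [i], not at 0, so that each summand has the layer shifts in
    which arcs from layer [i] are described. *)
Lemma card_layers (S : finType) (P : pred (S * 'Z_3)) (i : 'Z_3) :
  #|[set w | P w]| = (#|[set s | P (s, i)]| + #|[set s | P (s, (i + 1)%R)]|
                      + #|[set s | P (s, (i - 1)%R)]|)%N.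
Proof.
have cardE (T : finType) (Q : pred T) : #|[set s | Q s]| = (\sum_s Q s)%N.
  rewrite cardsE -sum1_card big_mkcond; apply: eq_bigr => s _.
  by rewrite unfold_in; case: (Q s).
rewrite !cardE -!big_split /=.
transitivity (\sum_s \sum_k P (s, k))%N.
  by rewrite pair_bigA; apply: eq_bigr => -[].
apply: eq_bigr => s _; have [n1 n2 n3 n4] := Z3_neq i.
rewrite (bigD1 i) //= (bigD1 (i + 1)) ?n1 //= (bigD1 (i - 1)) ?n2 ?n4 //=.
rewrite big1 ?addn0 ?addnA // => k /andP[/andP[/eqP ki /eqP ki1] /eqP ki2].
by case: (Z3_cases i k).
Qed.

End Layers.

(** Stating divisions as boolean equivalences lets a product equation be rewritten into a condition
    fixing one coordinate. *)
Lemma quasigroup_div (Q : finType) (op : Q -> Q -> Q) : quasigroup op ->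
  exists ld rd : Q -> Q -> Q,
    (forall a b x, (op a x == b) = (x == ld a b)) /\
    (forall a b y, (op y a == b) = (y == rd a b)).
Proof.
move=> hop.
(* Finite choice over the pairs [(a, b)] turns the pointwise unique solutions into a function. *)
have [ld ldP] : exists ld : Q * Q -> Q, forall ab x,
    (op ab.1 x == ab.2) = (x == ld ab).
  apply: (fin_all_exists (P := fun ab z => forall x, (op ab.1 x == ab.2) = (x == z))).
  move=> [a b]; have [[z [opz uz]] _] := hop a b; exists z => x.
  by apply/eqP/eqP => [/uz|->].
have [rd rdP] : exists rd : Q * Q -> Q, forall ab x,
    (op x ab.1 == ab.2) = (x == rd ab).
  apply: (fin_all_exists (P := fun ab z => forall x, (op x ab.1 == ab.2) = (x == z))).
  move=> [a b]; have [_ [z [opz uz]]] := hop a b; exists z => x.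
  by apply/eqP/eqP => [/uz|->].
exists (fun a b => ld (a, b)), (fun a b => rd (a, b)).
by split=> a b x; [rewrite -ldP | rewrite -rdP].
Qed.

(** * Arcs between given layers, and the symmetry of the digraph *)

Section Gamma2Theory.
Variables (n : nat) (op : 'I_n -> 'I_n -> 'I_n).
Local Notation e := (Gamma2 op).
Implicit Types s : ('I_n * 'I_n)%type.
Local Open Scope ring_scope.

(** The quantified [z] is always a coordinate of the head, so every existential disappears. The two
    families inside a layer are disjoint and merge into [rook]. *)
Lemma Gamma2E s i s' j : e (s, i) (s', j) =
  [|| (j == i) && rook s s', (j == i + 1) && (s'.1 == op s.1 s.2)
    | (j == i - 1) && (s'.2 == op s.2 s.1)].
Proof.
case: s s' => x y [a b]; rewrite /rook /=.
have -> : [exists z, (x != z) && ((a, b, j) == (z, y, i))] =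
          [&& j == i, y == b & x != a].
  apply/existsP/and3P => [[z /andP[xz /eqP[-> -> ->]]] //|[/eqP-> /eqP<- xa]].
  by exists a; rewrite xa /=.
have -> : [exists z, (y != z) && ((a, b, j) == (x, z, i))] =
          [&& j == i, x == a & y != b].
  apply/existsP/and3P => [[z /andP[xz /eqP[-> -> ->]]] //|[/eqP-> /eqP<- xa]].
  by exists b; rewrite xa /=.
have -> : [exists z, (a, b, j) == (op x y, z, i + 1)] =
          (j == i + 1) && (a == op x y).
  apply/existsP/andP => [[z /eqP[-> _ ->]] //|[/eqP-> /eqP->]].
  by exists b.
have -> : [exists z, (a, b, j) == (z, op y x, i - 1)] =
          (j == i - 1) && (b == op y x).
  apply/existsP/andP => [[z /eqP[_ -> ->]] //|[/eqP-> /eqP->]].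
  by exists a.
by rewrite orbA; congr (_ || _); case: (j == i); case: (x == a); case: (y == b).
Qed.

Lemma Gamma2_same s s' i : e (s, i) (s', i) = rook s s'.
Proof.
have [n1 n2 _ _] := Z3_neq i.
by rewrite Gamma2E eqxx ![i == _]eq_sym n1 n2 /= orbF.
Qed.

Lemma Gamma2_succ s s' i : e (s, i) (s', i + 1) = (s'.1 == op s.1 s.2).
Proof.
have [n1 _ n3 _] := Z3_neq i.
by rewrite Gamma2E eqxx n1 n3 /= orbF.
Qed.

Lemma Gamma2_pred s s' i : e (s, i) (s', i - 1) = (s'.2 == op s.2 s.1).
Proof.
have [_ n2 _ n4] := Z3_neq i.
by rewrite Gamma2E eqxx n2 n4.
Qed.

Lemma Gamma2_from_succ s s' i : e (s, i + 1) (s', i) = (s'.2 == op s.2 s.1).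
Proof. by rewrite -{2}[i](addrK 1) Gamma2_pred. Qed.

Lemma Gamma2_from_pred s s' i : e (s, i - 1) (s', i) = (s'.1 == op s.1 s.2).
Proof. by rewrite -{2}[i](subrK 1) Gamma2_succ. Qed.

Lemma Gamma2_succ_pred s s' i : e (s, i + 1) (s', i - 1) = (s'.1 == op s.1 s.2).
Proof. by rewrite -Z3_addr2 Gamma2_succ. Qed.

Lemma Gamma2_pred_succ s s' i : e (s, i - 1) (s', i + 1) = (s'.2 == op s.2 s.1).
Proof. by rewrite -Z3_subr2 Gamma2_pred. Qed.

(** Together the rules cover all ordered pairs of layers among [i], [i + 1] and [i - 1]; those
    joining [i + 1] and [i - 1] rest on 3 = 0. *)
Definition Gamma2_arcE := (Gamma2_same, Gamma2_succ, Gamma2_pred,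
  Gamma2_from_succ, Gamma2_from_pred, Gamma2_succ_pred, Gamma2_pred_succ).

Definition flip (u : 'I_n * 'I_n * 'Z_3) : 'I_n * 'I_n * 'Z_3 :=
  (u.1.2, u.1.1, - u.2).

Lemma flipK : involutive flip.
Proof. by case=> [[x y] i]; rewrite /flip /= opprK. Qed.

(** Swapping coordinates turns the condition on [op x y] into the one on [op y x], negating the
    layer swaps successor and predecessor, and [rook] is symmetric in the coordinates. *)
Lemma Gamma2_flip u v : e (flip u) (flip v) = e u v.
Proof.
case: u v => [[x y] i] [[a b] j]; rewrite !Gamma2E /rook /=.
rewrite -[- i + 1](opprK) -[- i - 1](opprK) !eqr_opp !opprD !opprK.
by rewrite addbC [X in _ || X]orbC.
Qed.

End Gamma2Theory.

(** * Counting degrees, undirected edges and paths of length 2 *)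

Theorem theorem5p1 (n : nat) (hn : 2 <= n) (op : 'I_n -> 'I_n -> 'I_n)
    (hop : quasigroup op) :
  dsrg (Gamma2 op) (3 * n ^ 2) (4 * n - 2) (2 * n) n 4.
Proof.
have [ld [rd [ldP rdP]]] := quasigroup_div hop.
have opI a : injective (op a).
  by move=> p q pq; have [[z [_ uz]] _] := hop a (op a q); rewrite -(uz p) // -(uz q).
have op'I b : injective (op^~ b).
  by move=> p q pq; have [_ [z [_ uz]]] := hop b (op q b); rewrite -(uz p) // -(uz q).
have card1 (P : pred ('I_n * 'I_n)) c d :
    (forall p q, P (p, q) = (p == c) && (q == d)) -> #|[set w | P w]| = 1.
  move=> PE; rewrite -(cards1 (c, d)); apply: eq_card => -[p q].
  by rewrite !inE PE.
(* The layer itself gives [n - 2] or 2 paths, and each other layer one: the first arc fixes one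
   coordinate of the middle vertex, the second then fixes the other by division. *)
have path_same s s' i : s != s' ->
    #|[set w | Gamma2 op (s, i) w && Gamma2 op w (s', i)]|
      = if Gamma2 op (s, i) (s', i) then n else 4.
  move=> ss'; rewrite (card_layers _ i) Gamma2_same.
  under eq_finset do rewrite !Gamma2_arcE.
  under [in X in _ + X + _]eq_finset do rewrite !Gamma2_arcE.
  under [in X in _ + _ + X]eq_finset do rewrite !Gamma2_arcE.
  rewrite card_rook2 // card_ord.
  rewrite (card1 _ (op s.1 s.2) (rd (op s.1 s.2) s'.2)).
    rewrite (card1 _ (rd (op s.2 s.1) s'.1) (op s.2 s.1)).
      by case: ifP; lia.
    move=> p q /=; rewrite andbC; have [->|] := eqVneq q; rewrite ?andbF //.
    by rewrite eq_sym rdP.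
  by move=> p q /=; have [->|] //= := eqVneq p; rewrite eq_sym rdP.
(* Middle layers [i], [i + 1], [i - 1] contribute 0, [n - 1], 1 if there is an arc, and 2, 1, 1
   otherwise. *)
have path_succ s s' i :
    #|[set w | Gamma2 op (s, i) w && Gamma2 op w (s', (i + 1)%R)]|
      = if Gamma2 op (s, i) (s', (i + 1)%R) then n else 4.
  rewrite (card_layers _ i) Gamma2_succ.
  under eq_finset do rewrite !Gamma2_arcE.
  under [in X in _ + X + _]eq_finset do rewrite !Gamma2_arcE.
  under [in X in _ + _ + X]eq_finset do rewrite !Gamma2_arcE.
  rewrite card_rook_column card_ord.
  rewrite [X in _ + _ + X](card1 _ (ld (op s.2 s.1) s'.2) (op s.2 s.1)); last first.
    move=> p q /=; rewrite andbC; have [->|] := eqVneq q; rewrite ?andbF //.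
    by rewrite eq_sym ldP.
  case: s s' => x y [a b] /=.
  have [->|axy] := eqVneq a (op x y).
    (* The symbol [op x y] of the Latin square recurs neither in row [x] nor in column [y]. *)
    rewrite (_ : [set _ | _] = set0) ?cards0; first by lia.
    apply/setP=> -[p q]; rewrite !inE /rook /=.
    have [<-|xp] := eqVneq x p.
      by rewrite (inj_eq (opI x)); case: (y == q).
    have [<-|//] := eqVneq y q.
    by rewrite (inj_eq (op'I y)) (negPf xp).
  (* The symbol [a] occurs once in row [x] and once in column [y]. These cells could only coincide
     at [(x, y)], whose symbol is not [a]. *)
  rewrite (_ : [set _ | _] = [set (x, ld x a); (rd y a, y)]).
    rewrite cards2 xpair_eqE -rdP eq_sym (negPf axy) /=; lia.
  apply/setP=> -[p q]; rewrite !inE /rook /= !xpair_eqE -rdP -ldP.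
  rewrite ![a == _]eq_sym ![x == _]eq_sym ![y == _]eq_sym.
  have [->|px] := eqVneq p x; have [->|qy] := eqVneq q y => //=.
  - by rewrite eq_sym (negPf axy).
  - by rewrite andbF orbF.
  - by rewrite andbT.
  by rewrite andbF.
split.
- by rewrite !card_prod !card_ord -mulnn mulnC.
- by case=> s i; rewrite Gamma2_same /rook !eqxx.
- case=> s i; rewrite (card_layers _ i).
  under eq_finset do rewrite !Gamma2_arcE.
  under [in X in _ + X + _]eq_finset do rewrite !Gamma2_arcE.
  under [in X in _ + _ + X]eq_finset do rewrite !Gamma2_arcE.
  (* The heads in each other layer form a full line, that is, the graph of a constant function. *)
  rewrite card_rook (card_graph2 (fun=> _)) (card_graph1 (fun=> _)) card_ord; lia.
- case=> s i; rewrite (card_layers _ i).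
  under eq_finset do rewrite !Gamma2_arcE rook_sym.
  under [in X in _ + X + _]eq_finset do rewrite !Gamma2_arcE eq_sym rdP.
  under [in X in _ + _ + X]eq_finset do rewrite !Gamma2_arcE eq_sym rdP.
  (* The tails in each other layer are the cells carrying a given symbol, hence the graph of a
     division. *)
  rewrite card_rook (card_graph1 (fun p => rd p s.2)).
  rewrite (card_graph2 (fun q => rd q s.1)) card_ord; lia.
- case=> s i; rewrite (card_layers _ i).
  under eq_finset do rewrite !Gamma2_arcE [X in _ && X]rook_sym andbb.
  under [in X in _ + X + _]eq_finset do rewrite !Gamma2_arcE.
  under [in X in _ + _ + X]eq_finset do rewrite !Gamma2_arcE.
  (* All rook arcs are undirected, and each other layer adds exactly one undirected edge:
     [2 * (n - 1) + 1 + 1]. *)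
  rewrite card_rook card_ord (card1 _ (op s.1 s.2) (rd (op s.1 s.2) s.2)).
    rewrite (card1 _ (rd (op s.2 s.1) s.1) (op s.2 s.1)); first by lia.
    move=> p q /=; rewrite andbC; have [->|] := eqVneq q; rewrite ?andbF //.
    by rewrite eq_sym rdP.
  by move=> p q /=; have [->|] //= := eqVneq p; rewrite eq_sym rdP.
case=> s i [s' j]; case: (Z3_cases i j) => -> => [uv | _ | _].
- by apply: path_same; move: uv; rewrite xpair_eqE eqxx andbT.
- exact: path_succ.
(* [flip] carries layers [i] and [i - 1] to [- i] and [- i + 1], so [path_succ] applies to the
   images; being injective, it preserves the number of middle vertices. *)
have flip_s : flip (s, i) = (s.2, s.1, (- i)%R) by [].
have flip_s' : flip (s', (i - 1)%R) = (s'.2, s'.1, (- i + 1)%R).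
  by rewrite /flip /= opprB addrC.
rewrite -(card_preimset _ (inv_inj (@flipK n))) -Gamma2_flip flip_s flip_s' -path_succ.
apply: eq_card => w; rewrite !inE -Gamma2_flip flipK flip_s; congr (_ && _).
by rewrite -Gamma2_flip flipK flip_s'.
Qed.
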